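(* For all integers $m\ge 2$ and $r\ge 1$, with $K_{m,r}=m+r-1-\left\lceil\frac{r-1}{m}\right\rceil$, \[ \sum_{k=1}^{K_{m,r}}B_{m,r,k}=m^{m+r-1}. \]
   Context: For an integer $d\ge 0$, $\binom{Y}{d}$ denotes the polynomial $Y(Y-1)\cdots(Y-d+1)/d!$. For integers $m\ge2$, $r\ge1$ and $d=m+r-1$, the shifted-binomial coordinates $B_{m,r,k}\in\mathbb{Q}$ ($1\le k\le d+1$) are defined as the unique rational numbers satisfying the polynomial identity in $n$ \[ \binom{mn}{d}=\sum_{k=1}^{d+1}B_{m,r,k}\binom{n+k-1}{d} \] (the polynomials $\binom{n+k-1}{d}$, $1\le k\le d+1$, form a basis of the $\mathbb{Q}$-vector space of polynomials of degree at most $d$). *)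

(* Defs.v *)
From HB Require Import structures.
From mathcomp Require Import all_boot all_order all_algebra.
Set Implicit Arguments.
Unset Strict Implicit.
Unset Printing Implicit Defensive.
Import Order.TTheory GRing.Theory Num.Theory.
Local Open Scope ring_scope.

(* The polynomial binom(Y, d); composing it with p on the right gives
   binom(p, d). *)
Definition binpoly (d : nat) : {poly rat} :=
  (d`!%:R)^-1 *: \prod_(i < d) ('X - i%:R%:P).

Definition deg (m r : nat) : nat := (m + r - 1)%N.

(* Entry i : 'I_(d + 1) of b is the coordinate of index k = i + 1. *)
Definition is_shifted_coords (m r : nat) (b : {ffun 'I_(deg m r).+1 -> rat}) : bool :=
  binpoly (deg m r) \Po (m%:R *: 'X) ==
  \sum_(i < (deg m r).+1) b i *: (binpoly (deg m r) \Po ('X + i%:R%:P)).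

Lemma size_binpoly_comp d (p : {poly rat}) :
  (size p <= 2)%N -> (size (binpoly d \Po p) <= d.+1)%N.
Proof.
move=> sp.
have sb : (size (binpoly d) <= d.+1)%N.
  apply: leq_trans (size_scale_leq _ _) _.
  by rewrite size_prod_XsubC /index_enum -enumT size_enum_ord.
apply: leq_trans (size_comp_poly_leq _ _) _; rewrite ltnS.
rewrite -[d in (_ <= d)%N]muln1; apply: leq_mul.
- by case: (size _) sb.
- by case: (size p) sp => [|[|[]]].
Qed.

Lemma binpoly_nat d (n : nat) : (binpoly d).[n%:R] = 'C(n, d)%:R.
Proof.
rewrite /binpoly hornerZ horner_prod.
have -> : \prod_(i < d) ('X - i%:R%:P).[n%:R] = (n ^_ d)%:R :> rat.
  elim: d => [|d IHd]; first by rewrite big_ord0 ffactn0.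
  rewrite big_ord_recr /= IHd !hornerE ffactnSr natrM.
  case: (leqP d n) => [le_dn|lt_nd]; first by rewrite natrB.
  by rewrite ffact_small // !mul0r.
rewrite -bin_ffact natrM mulrCA mulVf ?mulr1 //.
by rewrite pnatr_eq0 -lt0n fact_gt0.
Qed.

Lemma poly_eq_nat d (p q : {poly rat}) :
  (size p <= d.+1)%N -> (size q <= d.+1)%N ->
  (forall j : 'I_d.+1, p.[j%:R] = q.[j%:R]) -> p = q.
Proof.
move=> sp sq pq; apply/eqP; rewrite -subr_eq0; apply/eqP.
apply: (@roots_geq_poly_eq0 _ _ [seq j%:R | j <- iota 0 d.+1]).
- apply/allP => y /mapP[j]; rewrite mem_iota /= => ltj -> {y}.
  by rewrite rootE !hornerE (pq (Ordinal ltj)) subrr.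
- rewrite map_inj_uniq ?iota_uniq // => a b /eqP.
  by rewrite eqr_nat => /eqP.
- rewrite size_map size_iota; apply: leq_trans (size_polyD _ _) _.
  by rewrite size_polyN geq_max sp.
Qed.

Definition evalmx (d : nat) : 'M[rat]_d.+1 :=
  \matrix_(j, i) 'C(j + rev_ord i, d)%:R.

Lemma evalmx_unit d : evalmx d \in unitmx.
Proof.
have trig : is_trig_mx (evalmx d).
  apply/is_trig_mxP => j i ltji; rewrite mxE bin_small //=.
  rewrite subSS addnBA; last by rewrite -ltnS.
  by rewrite ltn_subLR ?ltn_add2r // (leq_trans _ (leq_addl _ _)) // -ltnS.
rewrite unitmxE (det_trig trig) big1 ?unitr1 // => i _.
by rewrite mxE /= subSS subnKC ?binn // -ltnS.
Qed.

Lemma shifted_combE d (b : {ffun 'I_d.+1 -> rat}) (j : 'I_d.+1) :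
  (\sum_(i < d.+1) b i *: (binpoly d \Po ('X + i%:R%:P))).[j%:R] =
  (evalmx d *m \col_i b (rev_ord i)) j 0.
Proof.
rewrite horner_sum mxE (reindex_inj rev_ord_inj) /=.
apply: eq_bigr => i _; rewrite !mxE hornerZ horner_comp hornerD hornerX hornerC.
by rewrite -natrD binpoly_nat mulrC.
Qed.

Lemma size_shifted_comb d (b : {ffun 'I_d.+1 -> rat}) :
  (size (\sum_(i < d.+1) b i *: (binpoly d \Po ('X + i%:R%:P)))%R <= d.+1)%N.
Proof.
apply: leq_trans (size_sum _ _ _) _; apply/bigmax_leqP => i _.
apply: leq_trans (size_scale_leq _ _) _; apply: size_binpoly_comp.
by rewrite size_XaddC.
Qed.

Lemma shifted_coords_exist (m r : nat) :
  exists b : {ffun 'I_(deg m r).+1 -> rat}, is_shifted_coords b.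
Proof.
set d := deg m r; set p := binpoly d \Po (m%:R *: 'X).
pose c := invmx (evalmx d) *m \col_(j < d.+1) p.[j%:R].
exists [ffun i => c (rev_ord i) 0]; apply/eqP.
apply: (@poly_eq_nat d); last 1 first.
- move=> j; rewrite shifted_combE.
  have -> : \col_i [ffun i => c (rev_ord i) 0] (rev_ord i) = c.
    by apply/colP => i; rewrite mxE ffunE rev_ordK.
  by rewrite mulKVmx ?evalmx_unit // mxE.
- apply: size_binpoly_comp; apply: leq_trans (size_scale_leq _ _) _.
  by rewrite size_polyX.
- exact: size_shifted_comb.
Qed.

Lemma shifted_coords_unique (m r : nat) (b b' : {ffun 'I_(deg m r).+1 -> rat}) :
  is_shifted_coords b -> is_shifted_coords b' -> b = b'.
Proof.
move=> /eqP E /eqP E'; set d := deg m r in b b' E E' *.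
have : evalmx d *m \col_i b (rev_ord i) = evalmx d *m \col_i b' (rev_ord i).
  by apply/colP => j; rewrite -!shifted_combE -E -E'.
move/(congr1 (mulmx (invmx (evalmx d)))); rewrite !mulKmx ?evalmx_unit //.
move=> /colP bb'; apply/ffunP => i.
by have := bb' (rev_ord i); rewrite !mxE rev_ordK.
Qed.

Definition shifted_coords (m r : nat) : {ffun 'I_(deg m r).+1 -> rat} :=
  xchoose (shifted_coords_exist m r).

(* Meaningful for 1 <= k <= d + 1 only. *)
Definition B (m r k : nat) : rat := shifted_coords m r (inord k.-1).

Lemma B_identity (m r : nat) :
  binpoly (deg m r) \Po (m%:R *: 'X) =
  \sum_(1 <= k < (deg m r).+2)
    B m r k *: (binpoly (deg m r) \Po ('X + (k%:R - 1)%:P)).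
Proof.
rewrite (eqP (xchooseP (shifted_coords_exist m r))) big_add1 big_mkord.
apply: eq_bigr => i _; rewrite /B /= inord_val.
by rewrite -natr1 addrK.
Qed.

Lemma B_unique (m r : nat) (b : nat -> rat) :
  binpoly (deg m r) \Po (m%:R *: 'X) =
  \sum_(1 <= k < (deg m r).+2)
    b k *: (binpoly (deg m r) \Po ('X + (k%:R - 1)%:P)) ->
  forall k, (1 <= k <= (deg m r).+1)%N -> b k = B m r k.
Proof.
move=> E [//|k] /= ltk.
pose b' := [ffun i : 'I_(deg m r).+1 => b i.+1].
have hb' : is_shifted_coords b'.
  apply/eqP; rewrite E big_add1 big_mkord; apply: eq_bigr => i _.
  by rewrite ffunE -natr1 addrK.
rewrite /B /shifted_coords -(shifted_coords_unique hb' (xchooseP (shifted_coords_exist m r))).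
by rewrite ffunE inordK.
Qed.

Definition K (m r : nat) : int :=
  m%:Z + r%:Z - 1 - Num.ceil ((r%:R - 1) / m%:R : rat).

(* Main.v *)
Require Import Defs.
From HB Require Import structures.
From mathcomp Require Import all_boot all_order all_algebra.
From mathcomp Require Import zify.
Import Order.TTheory GRing.Theory Num.Theory.
Local Open Scope ring_scope.

(** Every polynomial [binom(n + k - 1, d)] has leading coefficient [1 / d!],
    while [binom(m n, d)] has leading coefficient [m ^ d / d!]; comparing the
    coefficients of degree [d] shows that all the coordinates [B m r k] with
    [1 <= k <= d + 1] add up to [m ^ d] (lemma [sum_shifted_binpoly]).

    So the point is that the coordinates of index larger than [K m r] vanish.
    The basis is triangular at the points [0, 1, 2, ...]: the polynomial
    [binom(n + k - 1, d)] takes the value [0] at every natural number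
    [n < d + 1 - k], and the value [1] at [n = d + 1 - k].  Hence, if a polynomial
    vanishes at [0, ..., j], its last [j + 1] coordinates are zero (lemma
    [shifted_binpoly_coord_eq0]).  Now [binom(m n, d)] vanishes at every natural
    number [n] with [m n < d], so the coordinate of index [k] vanishes as soon as
    [m (d + 1 - k) < d].  Since [d = m + r - 1], this reads [d - k < (r - 1) / m],
    which is [k > K m r] by the definition of the ceiling (lemma [gt_K]). *)

Lemma size_binpoly d : size (binpoly d) = d.+1.
Proof.
rewrite size_scale ?invr_eq0 ?pnatr_eq0 -?lt0n ?fact_gt0 //.
by rewrite size_prod_XsubC /index_enum -enumT size_enum_ord.
Qed.

Lemma lead_coef_binpoly d : lead_coef (binpoly d) = (d`!%:R)^-1.
Proof.
rewrite lead_coefZ (monicP _) ?mulr1 //.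
exact: monic_prod_XsubC.
Qed.

Lemma coef_binpoly_comp d (q : {poly rat}) :
  size q = 2 -> (binpoly d \Po q)`_d = (d`!%:R)^-1 * lead_coef q ^+ d.
Proof.
move=> sq; have <- : lead_coef (binpoly d \Po q) = (binpoly d \Po q)`_d.
  by rewrite lead_coefE size_comp_poly size_binpoly sq muln1.
rewrite lead_coef_comp ?sq //.
by rewrite lead_coef_binpoly size_binpoly.
Qed.

Lemma horner_shifted_binpoly d j k : (0 < k)%N ->
  (binpoly d \Po ('X + (k%:R - 1)%:P)).[j%:R] = 'C(j + k.-1, d)%:R.
Proof.
case: k => // k _; rewrite -natr1 addrK horner_comp hornerD hornerX hornerC.
by rewrite -natrD binpoly_nat.
Qed.

(** Strong induction on [j]: at the point [j] the terms of index less than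
    [d + 1 - j] are zero, those of larger index have a zero coordinate by
    induction, and the remaining one is the coordinate itself. *)
Lemma shifted_binpoly_coord_eq0 d (p : {poly rat}) (b : nat -> rat) (j : nat) :
  p = \sum_(1 <= k < d.+2) b k *: (binpoly d \Po ('X + (k%:R - 1)%:P)) ->
  (j <= d)%N -> (forall i, (i <= j)%N -> p.[i%:R] = 0) -> b (d.+1 - j)%N = 0.
Proof.
move=> def_p; elim/ltn_ind: j => j IHj le_jd p0.
have := p0 j (leqnn j); rewrite {1}def_p horner_sum.
rewrite (bigD1_seq (d.+1 - j)%N); first last.
- exact: iota_uniq.
- by rewrite mem_index_iota; lia.
rewrite /= hornerZ horner_shifted_binpoly; last lia.
have -> : (j + (d.+1 - j).-1 = d)%N by lia.
rewrite binn mulr1 big_seq_cond big1 ?addr0 // => k.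
rewrite mem_index_iota => /andP[/andP[k_gt0 le_kd] neq_k].
rewrite hornerZ horner_shifted_binpoly //.
have [lt_k|ge_k] := ltnP k (d.+1 - j); first by rewrite bin_small ?mulr0 //; lia.
have -> : k = (d.+1 - (d.+1 - k))%N by lia.
rewrite IHj ?mul0r //; [lia | lia |].
by move=> i le_i; apply: p0; lia.
Qed.

Lemma sum_shifted_binpoly d (a : rat) (b : nat -> rat) : a != 0 ->
  binpoly d \Po (a *: 'X) =
    \sum_(1 <= k < d.+2) b k *: (binpoly d \Po ('X + (k%:R - 1)%:P)) ->
  \sum_(1 <= k < d.+2) b k = a ^+ d.
Proof.
move=> a0 /(congr1 (fun p : {poly rat} => p`_d)).
rewrite coef_binpoly_comp ?size_scale ?size_polyX // lead_coefZ lead_coefX mulr1.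
rewrite coef_sum (eq_bigr (fun k => (d`!%:R)^-1 * b k)) => [|k _]; last first.
  rewrite coefZ coef_binpoly_comp ?size_XaddC //.
  by rewrite lead_coefXaddC expr1n mulr1 mulrC.
rewrite -mulr_sumr => /mulfI-> //.
by rewrite invr_eq0 pnatr_eq0 -lt0n fact_gt0.
Qed.

(** Multiplying out the ceiling: [k > K m r] means [d - k < (r - 1) / m], and
    [d = m + (r - 1)]. *)
Lemma gt_K (m r k : nat) : (0 < m)%N -> (0 < r)%N -> (k <= (deg m r).+1)%N ->
  (K m r < k%:Z) = (m * ((deg m r).+1 - k) < deg m r)%N.
Proof.
move=> m_gt0 r_gt0 le_k.
have -> : (K m r < k%:Z) =
    ((deg m r)%:Z - k%:Z < Num.ceil ((r%:R - 1) / m%:R : rat)).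
  by rewrite /K /deg; apply/idP/idP; lia.
rewrite ceil_gt_int ltr_pdivlMr ?ltr0n //.
have -> : (r%:R - 1 : rat) = (r%:Z - 1)%:~R by rewrite rmorphB.
rewrite -[m%:R]/(m%:Z%:~R) -rmorphM ltr_int /=.
by move: le_k; rewrite /deg => le_k; apply/idP/idP; nia.
Qed.

Theorem theorem6p1 (m r : nat) (hm : (2 <= m)%N) (hr : (1 <= r)%N) :
  \sum_(1 <= k < (deg m r).+2 | k%:Z <= K m r) B m r k = m%:R ^+ (m + r - 1).
Proof.
have m_gt0 : (0 < m)%N by lia.
have m_neq0 : m%:R != 0 :> rat by rewrite pnatr_eq0 -lt0n.
rewrite -/(deg m r) -(sum_shifted_binpoly _ _ _ m_neq0 (B_identity m r)).
rewrite big_mkcond; apply: eq_big_nat => k /andP[k_gt0 le_k].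
case: leP => // ltK.
rewrite gt_K // in ltK.
have -> : k = ((deg m r).+1 - ((deg m r).+1 - k))%N by lia.
rewrite (shifted_binpoly_coord_eq0 _ _ _ _ (B_identity m r)) //; first lia.
move=> i le_i; rewrite horner_comp (hornerZ _ 'X) hornerX -natrM binpoly_nat bin_small //.
by apply: leq_ltn_trans ltK; rewrite leq_mul2l le_i orbT.
Qed.
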